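(* The set of all vulnerabilities across all software programs is countably infinite; that is, if $\Pi$ is the set of all software programs and $\mathcal{V}(\pi)$ is the set of vulnerabilities of program $\pi$, then $\bigl|\bigcup_{\pi\in\Pi}\mathcal{V}(\pi)\bigr|=\aleph_0$.
   Context: Software programs are finite strings over a finite alphabet. A vulnerability is a tuple $(c,t,p)$ of a software component $c$ (identifiable compilation unit), a CWE-classified weakness type $t$, and a parameter set $p$ determining exploit conditions; two vulnerabilities are distinct if their components differ or their parameter sets differ. For each program $\pi$, the set $\mathcal{V}(\pi)$ of its vulnerabilities (including those arising along its execution, e.g. in modules it generates) is at most countable. The Vulnerability Factory is a specific program which on each execution generates and compiles a new separate shared library $M_n$ ($n$ a persistent counter) containing five CVE-assignable vulnerabilities parameterised by $n$ (buffer size $16+n$, overflow threshold $\texttt{INT\_MAX}-n$, allocation size $8+n$, etc.), in addition to 11 base vulnerabilities. *)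

(* Defs.v *)
From mathcomp Require Import all_boot all_order all_algebra.
From mathcomp Require Import all_classical.

Set Implicit Arguments.
Unset Strict Implicit.
Unset Printing Implicit Defensive.

Local Open Scope classical_set_scope.
Local Open Scope card_scope.

Record vulnerability (C W P : Type) := Vulnerability {
  component : C;
  weakness : W;
  params : P
}.

(* Leibniz equality of triples realises the intended notion of distinctness. *)
Lemma distinct_vulnerability (C W P : Type) (v w : vulnerability C W P) :
  component v <> component w \/ params v <> params w -> v <> w.
Proof. by move=> [h|h] vw; apply: h; rewrite vw. Qed.

(* The world in which programs live; no axiom is bundled in this record.      *)
(* - Programs are the strings over the alphabet A that lie in [program].      *)
(* - A value of [pset] is a whole parameter set; the three partial            *)
(*   observers read off one parameter, when the set has it.                   *)
(* - [store] is the state that persists between executions.                   *)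
(* - [exec pi s G s'] means: one execution of pi started in the store s can   *)
(*   end in the store s', having generated and compiled the units in G.       *)
(* - [exhibits c t p] means: the unit c contains a CVE-assignable weakness    *)
(*   of type t with parameter set p.                                          *)
(* - [vulns pi] is the set V(pi).                                             *)
Record software_model (A : finType) := SoftwareModel {
  program : set (seq A);
  comp_unit : Type;
  cwe : Type;
  pset : Type;
  buffer_size : pset -> option nat;
  overflow_threshold : pset -> option int;
  alloc_size : pset -> option nat;
  store : Type;
  store0 : store;
  exec : seq A -> store -> set comp_unit -> store -> Prop;
  exhibits : comp_unit -> cwe -> pset -> Prop;
  vulns : seq A -> set (vulnerability comp_unit cwe pset)
}.

Arguments program {A} s _.
Arguments store0 {A} s.
Arguments exec {A} s _ _ _ _.
Arguments vulns {A} s _ _.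

Inductive reachable (A : finType) (S : software_model A) (pi : seq A) :
    store S -> Prop :=
| reachable0 : reachable pi (store0 S)
| reachableS s G s' :
    reachable pi s -> exec S pi s G s' -> reachable pi s'.

Definition generated (A : finType) (S : software_model A) (pi : seq A) :
    set (comp_unit S) :=
  [set c | exists s G s', [/\ reachable pi s, exec S pi s G s' & G c]].

(* INT_MAX is implementation-defined, hence a parameter. The thresholds       *)
(* INT_MAX - n are taken in Z, so that they make sense for every n.           *)
Record vulnerability_factory (A : finType) (S : software_model A)
    (INT_MAX : int) := VulnerabilityFactory {
  factory : seq A;
  factory_program : program S factory;
  counter : store S -> nat;
  M : nat -> comp_unit S;
  M_inj : injective M;
  factory_runs : forall s, reachable factory s ->
    exists G s', exec S factory s G s';
  factory_exec : forall s G s',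
    reachable factory s -> exec S factory s G s' ->
    G (M (counter s)) /\ counter s' = (counter s).+1;
  module_cwe : 'I_5 -> cwe S;
  module_params : nat -> 'I_5 -> pset S;
  (* two vulnerabilities of the same unit are told apart by their parameters *)
  module_params_inj : forall n, injective (module_params n);
  module_exhibits : forall n i,
    exhibits (M n) (module_cwe i) (module_params n i);
  module_buffer : forall n,
    buffer_size (module_params n (inord 0)) = Some (16 + n)%N;
  module_overflow : forall n,
    overflow_threshold (module_params n (inord 1))
      = Some (INT_MAX - Posz n)%R;
  module_alloc : forall n,
    alloc_size (module_params n (inord 2)) = Some (8 + n)%N;
  base : set (vulnerability (comp_unit S) (cwe S) (pset S));
  base_card : base #= `I_11;
  base_vulns : base `<=` vulns S factory;
  base_modules : forall v n, base v -> component v <> M n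
}.

(* Main.v *)
(* Strings over a finite alphabet are countably many, so the union is a countable
   union of countable sets.  Conversely, iterating the factory from a store whose
   counter is k generates the pairwise distinct units M k, M k.+1, ..., each of
   which exhibits a vulnerability. *)
Require Import Defs.
From mathcomp Require Import all_boot all_order all_algebra.
From mathcomp Require Import all_classical.

Local Open Scope classical_set_scope.
Local Open Scope card_scope.

Section Factory.
Variables (A : finType) (S : software_model A) (INT_MAX : int).
Variable F : vulnerability_factory S INT_MAX.

(** By [factory_runs] every reachable store admits a further execution, and each execution raises
    the counter by exactly one. *)
Lemma reachable_counter (n : nat) :
  exists2 s, reachable (factory F) s & counter F s = (counter F (store0 S) + n)%N.
Proof.
elim: n => [|n [s rs cs]]; first by exists (store0 S); [left|rewrite addn0].
have [G [s' e]] := factory_runs rs.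
exists s'; first exact: reachableS rs e.
by have [_ ->] := factory_exec rs e; rewrite cs addnS.
Qed.

Lemma generated_module (n : nat) :
  generated (factory F) (M F (counter F (store0 S) + n)).
Proof.
have [s rs cs] := reachable_counter n.
(* The unit is indexed by the counter before its increment, so it appears in the execution that
   starts from [s]. *)
have [G [s' e]] := factory_runs rs.
by exists s, G, s'; split=> //; rewrite -cs; have [] := factory_exec rs e.
Qed.

End Factory.

Theorem theorem9p1 (A : finType) (S : software_model A)
    (vulns_countable : forall pi : seq A,
      program S pi -> countable (vulns S pi))
    (vulns_generated : forall (pi : seq A) (c : comp_unit S) (t : cwe S)
        (p : pset S),
      program S pi -> generated pi c -> exhibits c t p ->
      vulns S pi (Vulnerability c t p))
    (INT_MAX : int) (F : vulnerability_factory S INT_MAX) :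
  (\bigcup_(pi in program S) vulns S pi) #= [set: nat].
Proof.
rewrite card_eq_le; apply/andP; split.
  by apply: bigcup_countable => //; exact: countableP.
pose k := counter F (store0 S).
(* One weakness is picked per module; the shift by [k] allows for any initial counter. *)
pose f n := Vulnerability (M F (k + n)) (module_cwe F ord0)
                          (module_params F (k + n) ord0).
have f_inj : injective f.
  (* The components already separate the values of [f]. *)
  by move=> m n [/(@M_inj _ _ _ F) /addnI].
have f_sub : range f `<=` \bigcup_(pi in program S) vulns S pi.
  move=> _ [n _ <-]; exists (factory F); first exact: factory_program.
  apply: vulns_generated; [exact: factory_program | exact: generated_module |].
  exact: module_exhibits.
apply: card_le_trans (subset_card_le f_sub).
by have := inj_card_eq (in2W f_inj : set_inj setT f); rewrite card_eq_le => /andP[].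
Qed.
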